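(* Let $\alpha_0,\alpha_1$ be complex parameters with $\alpha_0+\alpha_1=1$, and consider the Hamiltonian system $$\frac{dx}{dt}=\frac{\partial H}{\partial y},\quad \frac{dy}{dt}=-\frac{\partial H}{\partial x},\quad \frac{dz}{dt}=\frac{\partial H}{\partial w},\quad \frac{dw}{dt}=-\frac{\partial H}{\partial z}$$ with $$H=xy^2+x^2+tx-\alpha_0 y+\frac{z^2}{4}-\frac{w^2}{4}+yzw .$$ This system admits the affine Weyl group of type $A_1^{(1)}$ as a group of Bäcklund transformations, whose generators $s_0,s_1$ are defined as follows: with $( * ):=(x,y,z,w,t;\alpha_0,\alpha_1)$ and $f_1:=x+y^2+w^2+t$, $$s_0:( * )\mapsto\Big(x,\;y-\frac{\alpha_0}{x+z^2},\;z,\;w-\frac{2\alpha_0 z}{x+z^2},\;t;\;-\alpha_0,\;\alpha_1+2\alpha_0\Big),$$ $$s_1:( * )\mapsto\Big(x+\frac{2\alpha_1 y}{f_1}-\frac{\alpha_1^2}{f_1^2},\;y-\frac{\alpha_1}{f_1},\;z+\frac{2\alpha_1 w}{f_1},\;w,\;t;\;\alpha_0+2\alpha_1,\;-\alpha_1\Big).$$ That is, each $s_i$ is a Bäcklund transformation of the system, and $s_0,s_1$ satisfy the defining relations of the affine Weyl group of type $A_1^{(1)}$.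
   Context: A Bäcklund transformation here is a birational transformation of the variables $(x,y,z,w)$ (with coefficients depending rationally on $t$ and the parameters), together with a map on the parameters, such that if $(x,y,z,w)$ satisfies the system with parameters $(\alpha_0,\alpha_1)$ then the transformed variables satisfy the same system with the transformed parameters. The $s_i$ are composed as automorphisms of the field of rational functions in $x,y,z,w,t,\alpha_0,\alpha_1$ (modulo $\alpha_0+\alpha_1=1$). The affine Weyl group of type $A_1^{(1)}$ is $\langle s_0,s_1\mid s_0^2=s_1^2=1\rangle$ (the infinite dihedral group). *)

(* Defs.v *)
From HB Require Import structures.
From mathcomp Require Import all_boot all_order all_algebra fraction generic_quotient.
From mathcomp Require Import complex mpoly.
From mathcomp Require Import boolp classical_sets reals topology normedtype derive.

Set Implicit Arguments.
Unset Strict Implicit.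
Unset Printing Implicit Defensive.

Import GRing.Theory Num.Theory numFieldNormedType.Exports.
Local Open Scope ring_scope.
Local Open Scope complex_scope.

(* The six variables are x, y, z, w, t, alpha0, in this order; alpha1 is
   eliminated through alpha0 + alpha1 = 1, so that ratfun R is the field of
   rational functions in x, y, z, w, t, alpha0, alpha1 modulo this relation. *)
Notation polyfun R := {mpoly R[i][6]}.
Notation ratfun R := {fraction {mpoly R[i][6]}}.

Definition ix : 'I_6 := @Ordinal 6 0 isT.
Definition iy : 'I_6 := @Ordinal 6 1 isT.
Definition iz : 'I_6 := @Ordinal 6 2 isT.
Definition iw : 'I_6 := @Ordinal 6 3 isT.
Definition it : 'I_6 := @Ordinal 6 4 isT.
Definition ia : 'I_6 := @Ordinal 6 5 isT.

Definition tup6 (A : Type) (x y z w t a0 : A) : 'I_6 -> A :=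
  fun i => nth a0 [:: x; y; z; w; t; a0] i.

Section RationalFunctions.
Variable R : realType.

Definition var (i : 'I_6) : ratfun R := tofrac ('X_i : polyfun R).
Definition cst (c : R[i]) : ratfun R := tofrac (c%:MP : polyfun R).

Definition gx : ratfun R := var ix.
Definition gy : ratfun R := var iy.
Definition gz : ratfun R := var iz.
Definition gw : ratfun R := var iw.
Definition gt : ratfun R := var it.
Definition ga0 : ratfun R := var ia.
Definition ga1 : ratfun R := 1 - ga0.

(* r is regular at p with value v: some representation of r as a quotient of
   polynomials has a denominator not vanishing at p. *)
Definition has_value (r : ratfun R) (p : 'I_6 -> R[i]) (v : R[i]) : Prop :=
  exists n d : polyfun R,
    [/\ r = tofrac n / tofrac d, d.@[p] != 0 & v = n.@[p] / d.@[p]].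

Definition param_only (r : ratfun R) : Prop :=
  exists n d : {poly R[i]},
    d != 0 /\ r = (map_poly cst n).[ga0] / (map_poly cst d).[ga0].

(* Images of x, y, z, w; alpha0, alpha1. The variable t is kept fixed. *)
Record transformation := Transformation {
  im_x : ratfun R; im_y : ratfun R; im_z : ratfun R; im_w : ratfun R;
  im_a0 : ratfun R; im_a1 : ratfun R
}.

Definition images (T : transformation) : 'I_6 -> ratfun R :=
  tup6 (im_x T) (im_y T) (im_z T) (im_w T) gt (im_a0 T).

(* Substitution of the images for the variables, computed on the chosen
   representative fraction of r. Division by zero gives 0, but no nonzero
   denominator is sent to 0 as soon as this map is injective and sends 0
   to 0. *)
Definition subst (T : transformation) (r : ratfun R) : ratfun R :=
  mmap cst (images T) \n_(repr r) / mmap cst (images T) \d_(repr r).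

Definition field_automorphism (f : ratfun R -> ratfun R) : Prop :=
  [/\ {morph f : r s / r + s}, GRing.monoid_morphism f,
      forall c, f (cst c) = cst c & bijective f].

End RationalFunctions.

Section System.
Variable R : realType.

Definition hamiltonian : polyfun R :=
  let x : polyfun R := 'X_ix in let y : polyfun R := 'X_iy in
  let z : polyfun R := 'X_iz in let w : polyfun R := 'X_iw in
  let t : polyfun R := 'X_it in let a0 : polyfun R := 'X_ia in
  x * y ^+ 2 + x ^+ 2 + t * x - a0 * y
  + 4%:R^-1 *: z ^+ 2 - 4%:R^-1 *: w ^+ 2 + y * z * w.

(* Holomorphic solutions on an open set D of the complex plane;
   is_derive s 1 f l means that f has complex derivative l at s. *)
Definition solution (a0 a1 : R[i]) (D : set R[i]^o)
    (x y z w : R[i]^o -> R[i]^o) : Prop :=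
  [/\ a0 + a1 = 1, open D &
   forall s : R[i]^o, D s ->
     let p := tup6 (x s) (y s) (z s) (w s) s a0 in
     [/\ is_derive s 1 x (mderiv iy hamiltonian).@[p],
         is_derive s 1 y (- (mderiv ix hamiltonian).@[p]),
         is_derive s 1 z (mderiv iw hamiltonian).@[p] &
         is_derive s 1 w (- (mderiv iz hamiltonian).@[p])]].

(* Whenever T is defined along a solution, its value there is a solution for
   the transformed parameters b0, b1. *)
Definition preserves_solutions (T : transformation R) : Prop :=
  forall (a0 a1 b0 b1 : R[i]) (D : set R[i]^o)
         (x y z w X Y Z W : R[i]^o -> R[i]^o),
    solution a0 a1 D x y z w ->
    (forall s : R[i]^o, D s ->
      let p := tup6 (x s) (y s) (z s) (w s) s a0 in
      [/\ has_value (im_x T) p (X s), has_value (im_y T) p (Y s),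
          has_value (im_z T) p (Z s) & has_value (im_w T) p (W s)]) ->
    (forall x0 y0 z0 w0 t0 : R[i],
      let p := tup6 x0 y0 z0 w0 t0 a0 in
      has_value (im_a0 T) p b0 /\ has_value (im_a1 T) p b1) ->
    solution b0 b1 D X Y Z W.

(* A birational transformation, as an automorphism of the field of rational
   functions, acting on the parameters alone by a map that respects
   alpha0 + alpha1 = 1. *)
Definition backlund (T : transformation R) : Prop :=
  [/\ field_automorphism (subst T),
      param_only (im_a0 T), param_only (im_a1 T), im_a0 T + im_a1 T = 1
    & preserves_solutions T].

Definition f1 : ratfun R := gx R + gy R ^+ 2 + gw R ^+ 2 + gt R.

Definition s0 : transformation R :=
  let x := gx R in let y := gy R in let z := gz R in let w := gw R in
  let a0 := ga0 R in let a1 := ga1 R in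
  Transformation
    x (y - a0 / (x + z ^+ 2)) z (w - (2%:R * a0 * z) / (x + z ^+ 2))
    (- a0) (a1 + 2%:R * a0).

Definition s1 : transformation R :=
  let x := gx R in let y := gy R in let z := gz R in let w := gw R in
  let a0 := ga0 R in let a1 := ga1 R in
  Transformation
    (x + (2%:R * a1 * y) / f1 - a1 ^+ 2 / f1 ^+ 2) (y - a1 / f1)
    (z + (2%:R * a1 * w) / f1) w
    (a0 + 2%:R * a1) (- a1).

End System.

(* Main.v *)
(** Each [s_i] fixes its own denominator [g] ([x + z^2] for [s0], [f1] for
    [s1]), and along a solution [g' = 2 y g - alpha0], respectively
    [f1' = alpha1 - 2 y f1]; the differential equations for the transformed
    variables follow from this by a direct computation. Write [phi] for the
    ring morphism from polynomials to rational functions given by [s_i].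
    Up to a power of [g], [phi] sends every polynomial [p] to a polynomial
    which [phi] sends back to [p] up to the same power. Hence [phi] is
    injective and its extension to the field of fractions is an involution.
    The transformed [y] has a genuine pole along [g = 0]: substituting [x - g]
    for [x], which eliminates [x], kills [g] but not the numerator. So
    regularity of the transformed variables along a solution forces [g] to be
    nonzero there. *)

From HB Require Import structures.
Require Import Defs.
From mathcomp Require Import all_boot all_order all_algebra reals.
From mathcomp Require Import fraction generic_quotient complex mpoly.
From mathcomp Require Import classical_sets topology normedtype derive ring.

Set Implicit Arguments.
Unset Strict Implicit.
Unset Printing Implicit Defensive.

Import GRing.Theory Num.Theory numFieldNormedType.Exports.
Local Open Scope ring_scope.
Local Open Scope complex_scope.

(** * The system and its transformations along a solution *)

Section Derivatives.
Variable K : numFieldType.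
Implicit Types (f g x y z w : K^o -> K^o) (s l m : K^o) (a b c : K).

Lemma is_derive_cst_fun c s : is_derive s 1 ((fun=> c) : K^o -> K^o) 0.
Proof. exact: is_derive_cst. Qed.

Lemma is_derive_add f g s l m : is_derive s 1 f l -> is_derive s 1 g m ->
  is_derive s 1 (fun u => f u + g u) (l + m).
Proof. by move=> fl gm; apply: is_deriveD. Qed.

Lemma is_derive_sub f g s l m : is_derive s 1 f l -> is_derive s 1 g m ->
  is_derive s 1 (fun u => f u - g u) (l - m).
Proof. by move=> fl gm; apply: is_deriveB. Qed.

Lemma is_derive_mul f g s l m : is_derive s 1 f l -> is_derive s 1 g m ->
  is_derive s 1 (fun u => f u * g u) (f s * m + g s * l).
Proof. by move=> fl gm; apply: is_deriveM. Qed.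

Lemma is_derive_sqr f s l : is_derive s 1 f l ->
  is_derive s 1 (fun u => f u ^+ 2) (2%:R * f s * l).
Proof. by move=> fl; apply: is_derive_eq (is_derive_mul fl fl) _; ring. Qed.

Lemma is_derive_div f g s l m : g s != 0 ->
  is_derive s 1 f l -> is_derive s 1 g m ->
  is_derive s 1 (fun u => f u / g u) ((l * g s - f s * m) / g s ^+ 2).
Proof.
move=> gs fl [gd gm].
have gV : is_derive s 1 (fun u => (g u)^-1) (- (g s) ^- 2 * m).
  by apply: DeriveDef; [exact: derivableV|rewrite deriveV// gm].
by apply: is_derive_eq (is_derive_mul fl gV) _; field.
Qed.

(** The transformed functions are known to agree with the explicit formulas only on the domain [D],
    so derivatives are transferred locally. *)
Lemma is_derive_congr (D : set K^o) f g s l :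
  open D -> D s -> (forall u, D u -> f u = g u) -> is_derive s 1 f l ->
  is_derive s 1 g l.
Proof.
move=> oD Ds fg; apply: near_eq_is_derive.
by apply: filterS (open_nbhs_nbhs (conj oD Ds)).
Qed.

(** The partial derivatives of [H] are written out, over an abstract field where [field] settles the
    identities. *)
Definition hamilton_at a x y z w s : Prop :=
  [/\ is_derive s 1 x (2%:R * x s * y s - a + z s * w s),
      is_derive s 1 y (- (y s ^+ 2 + 2%:R * x s + s)),
      is_derive s 1 z (y s * z s - w s / 2%:R) &
      is_derive s 1 w (- (z s / 2%:R + y s * w s))].

Lemma hamilton_at_congr (D : set K^o) a x y z w x' y' z' w' s :
  open D -> D s ->
  (forall u, D u -> [/\ x u = x' u, y u = y' u, z u = z' u & w u = w' u]) ->
  hamilton_at a x y z w s -> hamilton_at a x' y' z' w' s.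
Proof.
move=> oD Ds eqD [dx dy dz dw]; rewrite /hamilton_at.
have [<- <- <- <-] := eqD s Ds.
split; [apply: is_derive_congr dx|apply: is_derive_congr dy|
  apply: is_derive_congr dz|apply: is_derive_congr dw];
  by [exact: oD|exact: Ds|move=> u /eqD[]].
Qed.

Lemma hamilton_at_s0 a x y z w s :
  hamilton_at a x y z w s -> x s + z s ^+ 2 != 0 ->
  hamilton_at (- a) x (fun u => y u - a / (x u + z u ^+ 2)) z
    (fun u => w u - 2%:R * a * z u / (x u + z u ^+ 2)) s.
Proof.
move=> [dx dy dz dw]; pose g u := x u + z u ^+ 2.
rewrite -/(g s) => g0.
(* The terms in [z w] coming from [x'] and from [2 z z'] cancel. *)
have dg : is_derive s 1 g (2%:R * y s * g s - a).
  by apply: is_derive_eq (is_derive_add dx (is_derive_sqr dz)) _; rewrite /g; field.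
split.
(* Here [x] is unchanged, and so is its equation: [2 a - 2 a x / g - 2 a z^2 / g = 0]. *)
- by apply: is_derive_eq dx _; move: g0; rewrite /g => g0; field.
- apply: is_derive_eq
    (is_derive_sub dy (is_derive_div g0 (is_derive_cst_fun a s) dg)) _.
  by move: g0; rewrite /g => g0; field.
- by apply: is_derive_eq dz _; move: g0; rewrite /g => g0; field.
- have dn := is_derive_mul (is_derive_cst_fun (2%:R * a) s) dz.
  apply: is_derive_eq (is_derive_sub dw (is_derive_div g0 dn dg)) _.
  by move: g0; rewrite /g => g0; field.
Qed.

Lemma hamilton_at_s1 a b x y z w s : a + b = 1 ->
  hamilton_at a x y z w s ->
  let f u := x u + y u ^+ 2 + w u ^+ 2 + u in f s != 0 ->
  hamilton_at (a + 2%:R * b)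
    (fun u => x u + 2%:R * b * y u / f u - b ^+ 2 / f u ^+ 2)
    (fun u => y u - b / f u) (fun u => z u + 2%:R * b * w u / f u) w s.
Proof.
move=> ab [dx dy dz dw] f f0.
have aE : a = 1 - b by rewrite -ab addrK.
(* The explicit time in [f] contributes [1], and [1 - a = b]. *)
have df : is_derive s 1 f (b - 2%:R * y s * f s).
  have d := is_derive_add (is_derive_add dx (is_derive_sqr dy)) (is_derive_sqr dw).
  apply: is_derive_eq (is_derive_add d (is_derive_id s 1)) _.
  by rewrite aE /f in f0 *; field.
have f20 : f s ^+ 2 != 0 by rewrite expf_eq0.
split.
- have d1 := is_derive_div f0
    (is_derive_mul (is_derive_cst_fun (2%:R * b) s) dy) df.
  have d2 := @is_derive_div (fun=> b ^+ 2) (fun u => f u ^+ 2) s _ _ f20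
    (is_derive_cst_fun _ _) (is_derive_sqr df).
  apply: is_derive_eq (is_derive_sub (is_derive_add dx d1) d2) _.
  by rewrite aE /f in f0 *; field.
- apply: is_derive_eq
    (is_derive_sub dy (is_derive_div f0 (is_derive_cst_fun b s) df)) _.
  by rewrite /f in f0 *; field.
- have dn := is_derive_mul (is_derive_cst_fun (2%:R * b) s) dw.
  apply: is_derive_eq (is_derive_add dz (is_derive_div f0 dn df)) _.
  by rewrite /f in f0 *; field.
- by apply: is_derive_eq dw _; rewrite /f in f0 *; field.
Qed.

End Derivatives.

(** * Substitution in rational functions *)

Section Fractions.
Variable D : idomainType.

Lemma tofrac_inj : injective (@tofrac D).
Proof. by move=> p q /eqP; rewrite tofrac_eq => /eqP. Qed.

Lemma tofrac_nat n : tofrac n%:R = n%:R :> {fraction D}.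
Proof. by rewrite tofracMn tofrac1. Qed.

Import FracField.
Local Open Scope quotient_scope.

(** Ties the representative on which [subst] computes to the rational function itself. *)
Lemma tofrac_numden (r : {fraction D}) :
  tofrac \n_(repr r) / tofrac \d_(repr r) = r.
Proof.
have d0 : tofrac \d_(repr r) != 0 by rewrite tofrac_eq0 denom_ratioP.
apply: (mulIf d0); rewrite divfK//.
rewrite -[in RHS](reprK r); unlock tofrac; rewrite -[RHS]pi_mul.
by apply/eqmodP; rewrite /= equivfE /mulf !numden_Ratio ?oner_neq0 ?mulr1
  ?mul1r ?denom_ratioP ?reprK.
Qed.

End Fractions.

Lemma forall_I6 (P : 'I_6 -> Prop) :
  P ix -> P iy -> P iz -> P iw -> P it -> P ia -> forall i, P i.
Proof.
move=> Px Py Pz Pw Pt Pa [[|[|[|[|[|[|m]]]]]] m6] //.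
all: by rewrite (bool_irrelevance m6 isT).
Qed.

Section Substitution.
Variable R : realType.
Implicit Types (T : transformation R) (p q : polyfun R).

Fact cst_is_zmod_morphism : zmod_morphism (@cst R).
Proof. by move=> c d; rewrite /cst mpolyCB rmorphB. Qed.

Fact cst_is_monoid_morphism : GRing.monoid_morphism (@cst R).
Proof. by split=> [|c d]; rewrite /cst ?mpolyC1 ?rmorph1// mpolyCM rmorphM. Qed.

HB.instance Definition _ :=
  GRing.isZmodMorphism.Build _ _ (@cst R) cst_is_zmod_morphism.
HB.instance Definition _ :=
  GRing.isMonoidMorphism.Build _ _ (@cst R) cst_is_monoid_morphism.

Definition phi T : polyfun R -> ratfun R := mmap (@cst R) (images T).

HB.instance Definition _ T :=
  GRing.RMorphism.copy (phi T) (mmap (@cst R) (images T)).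

Lemma phi0 T : phi T 0 = 0. Proof. exact: rmorph0. Qed.
Lemma phi1 T : phi T 1 = 1. Proof. exact: rmorph1. Qed.
Lemma phi_nat T n : phi T n%:R = n%:R. Proof. exact: rmorph_nat. Qed.
Lemma phiN T : {morph phi T : p / - p}. Proof. exact: rmorphN. Qed.
Lemma phiD T : {morph phi T : p q / p + q}. Proof. exact: rmorphD. Qed.
Lemma phiB T : {morph phi T : p q / p - q}. Proof. exact: rmorphB. Qed.
Lemma phiM T : {morph phi T : p q / p * q}. Proof. exact: rmorphM. Qed.
Lemma phiXn T n : {morph phi T : p / p ^+ n}. Proof. exact: rmorphXn. Qed.
Lemma phiC T c : phi T c%:MP = cst c. Proof. exact: mmapC. Qed.
Lemma phiX T i : phi T 'X_i = images T i.
Proof. by rewrite /phi mmapX mmap1U. Qed.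

Lemma phi_neq0 T p : injective (phi T) -> p != 0 -> phi T p != 0.
Proof. by move=> inj p0; rewrite -(phi0 T) (inj_eq inj). Qed.

(** Injectivity keeps denominators nonzero; cross-multiplication then shows that the choice of
    representative does not matter. *)
Lemma subst_frac T p q : injective (phi T) -> q != 0 ->
  subst T (tofrac p / tofrac q) = phi T p / phi T q.
Proof.
move=> inj q0; rewrite /subst -/(phi T).
set r := tofrac p / tofrac q.
have d0 : \d_(repr r) != 0 by apply: denom_ratioP.
apply/eqP; rewrite eqr_div ?phi_neq0// -!phiM (inj_eq inj).
rewrite -(inj_eq (@tofrac_inj _)) !tofracM -eqr_div ?tofrac_eq0//.
by rewrite tofrac_numden.
Qed.

(** Sums and products of fractions are computed through [phi T], and an involution is its own
    inverse. *)
Lemma subst_automorphism T :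
  injective (phi T) -> subst T \o subst T =1 id -> field_automorphism (subst T).
Proof.
move=> inj invo.
have frac r : exists p q : polyfun R, q != 0 /\ r = tofrac p / tofrac q.
  exists \n_(repr r), \d_(repr r); split; first exact: denom_ratioP.
  by rewrite tofrac_numden.
split.
- move=> r1 r2.
  have [p1 [q1 [q10 ->]]] := frac r1; have [p2 [q2 [q20 ->]]] := frac r2.
  rewrite addf_div ?tofrac_eq0// -!tofracM -tofracD !subst_frac ?mulf_neq0//.
  by rewrite addf_div ?phi_neq0// -!phiM -phiD.
- split.
    by rewrite -[1 in LHS]divr1 -tofrac1 subst_frac ?oner_neq0// phi1 divr1 tofrac1.
  move=> r1 r2.
  have [p1 [q1 [q10 ->]]] := frac r1; have [p2 [q2 [q20 ->]]] := frac r2.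
  by rewrite mulf_div -!tofracM !subst_frac ?mulf_neq0// mulf_div -!phiM.
- move=> c; rewrite -[cst c in LHS]divr1 -tofrac1 subst_frac ?oner_neq0//.
  by rewrite phi1 phiC divr1.
- by exists (subst T) => r; apply: invo.
Qed.

(** * Involutions with an invariant denominator *)

Section Involution.
Variables (T : transformation R) (g : polyfun R) (k : nat).
Variable num : 'I_6 -> polyfun R.
Hypotheses (g0 : g != 0) (phig : phi T g = tofrac g).
Hypothesis im_num : forall i, images T i * tofrac g ^+ k = tofrac (num i).
Hypothesis phi_num : forall i, phi T (num i) = tofrac ('X_i * g ^+ k).

(** The first equation makes [p'] the numerator of [phi T p] over [g ^+ m]; the second is
    involutivity at [p], freed of denominators. *)
Let cleared p m p' :=
  phi T p * tofrac g ^+ m = tofrac p' /\ phi T p' = tofrac (p * g ^+ m).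

Let clearedM p1 m1 p1' p2 m2 p2' : cleared p1 m1 p1' -> cleared p2 m2 p2' ->
  cleared (p1 * p2) (m1 + m2) (p1' * p2').
Proof.
move=> [e1 e2] [e3 e4]; split.
  by rewrite phiM tofracM -e1 -e3 exprD mulrACA.
by rewrite phiM e2 e4 -tofracM exprD mulrACA.
Qed.

Let clearedC c : cleared c%:MP 0 c%:MP.
Proof. by split; rewrite expr0 mulr1 phiC. Qed.

(** Since [phi T] fixes [g], exponents can be raised; sums need a common one. *)
Let cleared_shift p m p' n :
  cleared p m p' -> cleared p (m + n) (p' * g ^+ n).
Proof.
move=> [e1 e2]; split; first by rewrite tofracM -e1 tofracXn exprD mulrA.
by rewrite phiM e2 phiXn phig -tofracXn -tofracM exprD mulrA.
Qed.

(** The hypotheses give this for the variables; products give monomials, and a common exponent gives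
    sums. *)
Lemma phi_clear p : exists m p',
  phi T p * tofrac g ^+ m = tofrac p' /\ phi T p' = tofrac (p * g ^+ m).
Proof.
rewrite -/(cleared p _ _).
have mon m : exists n p', cleared 'X_[m] n p'.
  rewrite mpolyXE_id; elim/big_rec: _ => [|i p' _ [n1 [p1 IH1]]].
    by exists 0%N, 1; exact: (clearedC 1).
  suff [n2 [p2 IH2]] : exists n p', cleared ('X_i ^+ m i) n p'.
    by exists (n2 + n1)%N, (p2 * p1); exact: clearedM.
  elim: (m i) => [|n [n2 [p2 IH2]]].
    by exists 0%N, 1; exact: (clearedC 1).
  exists (k + n2)%N, (num i * p2); rewrite [_ ^+ n.+1]exprS.
  by apply: clearedM IH2; split; rewrite ?phiX.
elim/mpolyind: p => [|c m p _ _ [n1 [p1 IH1]]].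
  by exists 0%N, 0; exact: (clearedC 0).
have [n2 [p2 IH2]] := mon m.
have [e1 e2] := cleared_shift n1 (clearedM (clearedC c) IH2).
have [e3 e4] := cleared_shift n2 IH1.
(* Each numerator is multiplied by the power of [g] belonging to the other. *)
exists (n1 + n2)%N, (c%:MP * p2 * g ^+ n1 + p1 * g ^+ n2).
split; rewrite -mul_mpolyC phiD !mulrDl.
  by rewrite e3 tofracD -e1 add0n addnC.
by rewrite e2 e4 tofracD add0n addnC.
Qed.

(** If [phi T] kills [p1 - p2], its cleared numerator is zero; applying [phi T] to that numerator
    gives [(p1 - p2) * g ^+ m = 0]. *)
Lemma phi_inj : injective (phi T).
Proof.
move=> p1 p2 e; apply/eqP; rewrite -subr_eq0.
have [m [p' [e1 e2]]] := phi_clear (p1 - p2).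
move: e1; rewrite phiB e subrr mul0r => /esym/eqP.
rewrite tofrac_eq0 => /eqP p'0.
move: e2; rewrite p'0 phi0 => /esym/eqP; rewrite tofrac_eq0 mulf_eq0.
by rewrite expf_eq0 (negbTE g0) andbF orbF.
Qed.

Lemma subst_involutive : subst T \o subst T =1 id.
Proof.
have gm m : g ^+ m != 0 by rewrite expf_neq0.
have inj := phi_inj.
(* Involutivity on polynomials: the second application yields [p * g ^+ m / g ^+ m]. *)
have frac_phi p : exists p' m, phi T p = tofrac p' / tofrac (g ^+ m) /\
    phi T p' / phi T (g ^+ m) = tofrac p.
  have [m [p' [e1 e2]]] := phi_clear p; exists p', m.
  rewrite -e1 e2 phiXn phig -tofracXn.
  by rewrite mulfK ?tofrac_eq0// tofracM mulfK ?tofrac_eq0.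
move=> r /=; rewrite -[r in LHS]tofrac_numden.
have d0 : \d_(repr r) != 0 by apply: denom_ratioP.
rewrite subst_frac//.
have [p1 [m1 [e1 e2]]] := frac_phi \n_(repr r).
have [p2 [m2 [e3 e4]]] := frac_phi \d_(repr r).
(* The numerator [p2] moves into a denominator when the quotient is inverted. *)
have p20 : p2 != 0.
  apply/eqP=> p20; move: e4; rewrite p20 phi0 mul0r => /esym/eqP.
  by rewrite tofrac_eq0 (negbTE d0).
rewrite e1 e3 invf_div mulf_div -!tofracM subst_frac ?mulf_neq0// !phiM.
by rewrite -mulf_div e2 -[X in _ * X]invf_div e4 tofrac_numden.
Qed.

Lemma involution_automorphism : field_automorphism (subst T).
Proof. exact: subst_automorphism phi_inj subst_involutive. Qed.

End Involution.
End Substitution.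

(** * Values of rational functions at a point *)

Section HasValue.
Variable R : realType.
Local Notation X i := ('X_i : polyfun R).
Implicit Types (n d g h p q : polyfun R) (v : 'I_6 -> R[i]) (c : R[i]).

Lemma mevalXn v k : {morph meval v : p / p ^+ k}.
Proof. exact: rmorphXn. Qed.

Lemma meval_nat v k : (k%:R : polyfun R).@[v] = k%:R.
Proof. exact: rmorph_nat. Qed.

Lemma meval_neq0 v p : p.@[v] != 0 -> p != 0.
Proof. by apply: contraNneq => ->; rewrite meval0. Qed.

(** Two representations satisfy a cross-multiplied polynomial identity, which can be evaluated at
    [v]. *)
Lemma has_value_frac n d v c : d.@[v] != 0 ->
  has_value (tofrac n / tofrac d) v c -> c = n.@[v] / d.@[v].
Proof.
move=> dv [n' [d' [e d'v ->]]]; apply/eqP; rewrite eqr_div// -!mevalM.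
have [d0 d'0] := (meval_neq0 dv, meval_neq0 d'v).
move/eqP: e; rewrite eqr_div ?tofrac_eq0// -!tofracM tofrac_eq => /eqP ->.
by [].
Qed.

Lemma has_value_tofrac r n v c : r = tofrac n -> has_value r v c -> c = n.@[v].
Proof.
move=> ->; rewrite -[tofrac n]divr1 -tofrac1 => /has_value_frac.
by rewrite meval1 divr1; apply; exact: oner_neq0.
Qed.

Lemma has_value_images (T : transformation R) g (q : 'I_6 -> polyfun R) k i v c :
  g.@[v] != 0 ->
  images T i * tofrac g ^+ k = tofrac (q i) ->
  has_value (images T i) v c -> c = (q i).@[v] / g.@[v] ^+ k.
Proof.
move=> gv e; have gk0 : tofrac (g ^+ k) != 0.
  by rewrite tofrac_eq0 expf_neq0// (meval_neq0 gv).
rewrite -[images T i](mulfK gk0) tofracXn e -tofracXn => /has_value_frac.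
by rewrite mevalXn; apply; rewrite expf_neq0.
Qed.

(** * Poles along a hypersurface *)

(** When [h] is [x] plus terms free of [x], this substitution kills [h] and acts as restriction to
    the graph [h = 0]. *)
Definition elim_x h p : polyfun R :=
  p \mPo [tuple X ix - h; X iy; X iz; X iw; X it; X ia].

Lemma elim_x1 h : elim_x h 1 = 1. Proof. exact: rmorph1. Qed.
Lemma elim_xD h : {morph elim_x h : p q / p + q}. Proof. exact: rmorphD. Qed.
Lemma elim_xB h : {morph elim_x h : p q / p - q}. Proof. exact: rmorphB. Qed.
Lemma elim_xM h : {morph elim_x h : p q / p * q}. Proof. exact: rmorphM. Qed.
Lemma elim_xXn h k : {morph elim_x h : p / p ^+ k}. Proof. exact: rmorphXn. Qed.
Lemma elim_xX h i :
  elim_x h (X i) = [tuple X ix - h; X iy; X iz; X iw; X it; X ia]`_i.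
Proof. exact: comp_mpolyXU. Qed.

Lemma elim_x_meval h p v : h.@[v] = 0 -> (elim_x h p).@[v] = p.@[v].
Proof.
move=> hv; rewrite /elim_x comp_mpoly_meval; apply: meval_eq; apply: forall_I6.
all: by rewrite (tnth_nth 0) /= ?mevalB ?mevalXU ?hv ?subr0.
Qed.

(** If [r = n / d], then [n * h = q * d]. Eliminating [x] kills the left side but not [q], hence
    kills [d], so [d] vanishes wherever [h] does. The value of [q] at [v] never enters: points where
    the numerator vanishes too are covered. *)
Lemma has_value_denom_neq0 (r : ratfun R) h q v c :
  r * tofrac h = tofrac q -> elim_x h h = 0 -> elim_x h q != 0 ->
  has_value r v c -> h.@[v] != 0.
Proof.
move=> rq hh hq [n [d [e dv _]]].
apply: contraNneq (dv) => hv.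
have d0 : tofrac d != 0 by rewrite tofrac_eq0 (meval_neq0 dv).
have E : n * h = q * d.
  by apply: tofrac_inj; rewrite !tofracM -rq e mulrAC divfK.
have Eqd : elim_x h q * elim_x h d = 0.
  by rewrite -elim_xM -E elim_xM hh mulr0.
have dh : elim_x h d = 0 by apply: (mulfI hq); rewrite Eqd mulr0.
by rewrite -(elim_x_meval d hv) dh meval0.
Qed.

End HasValue.

(** * The equations of motion *)

Section Hamiltonian.
Variable R : realType.
Local Notation X i := ('X_i : polyfun R).

Lemma mderivXU i j : mderiv j (X i) = (i == j)%:R.
Proof.
rewrite mderivX mnm1E; case: eqVneq => [->|_]; last by rewrite scale0r.
rewrite (_ : (U_(j) - U_(j))%MM = 0%MM) ?mpolyX0 ?scale1r//.
by apply/mnmP => k; rewrite mnmBE subnn mnm0E.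
Qed.

Section Gradient.
Variables (i : 'I_6) (v : 'I_6 -> R[i]).
Local Notation grad p := (mderiv i p).@[v].
Implicit Types p q : polyfun R.

Lemma gradD p q : grad (p + q) = grad p + grad q.
Proof. by rewrite mderivD mevalD. Qed.

Lemma gradB p q : grad (p - q) = grad p - grad q.
Proof. by rewrite mderivB mevalB. Qed.

Lemma gradM p q : grad (p * q) = grad p * q.@[v] + p.@[v] * grad q.
Proof. by rewrite mderivM mevalD !mevalM. Qed.

Lemma gradX j : grad (X j) = (j == i)%:R.
Proof. by rewrite mderivXU; case: eqP; rewrite ?meval1 ?meval0. Qed.

Lemma gradX2 j : grad (X j ^+ 2) = 2%:R * v j * (j == i)%:R.
Proof. by rewrite expr2 gradM gradX mevalXU; ring. Qed.

Lemma gradZX2 c j : grad (c *: X j ^+ 2) = c * (2%:R * v j * (j == i)%:R).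
Proof. by rewrite mderivZ mevalZ gradX2. Qed.

Lemma gradXX j k : grad (X j * X k) = (j == i)%:R * v k + v j * (k == i)%:R.
Proof. by rewrite gradM !gradX !mevalXU. Qed.

Lemma gradXX2 j k : grad (X j * X k ^+ 2) =
  (j == i)%:R * v k ^+ 2 + v j * (2%:R * v k * (k == i)%:R).
Proof. by rewrite gradM gradX2 gradX mevalXn !mevalXU. Qed.

Lemma gradXXX j k l : grad (X j * X k * X l) =
  ((j == i)%:R * v k + v j * (k == i)%:R) * v l + v j * v k * (l == i)%:R.
Proof. by rewrite gradM gradXX gradX mevalM !mevalXU. Qed.

(** A single computation serves all the partial derivatives; the Kronecker symbols [d j] select the
    terms. *)
Lemma grad_hamiltonian : let d j : R[i] := (j == i)%:R in
  grad (hamiltonian R) =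
  d ix * v iy ^+ 2 + v ix * (2%:R * v iy * d iy) + 2%:R * v ix * d ix
  + (d it * v ix + v it * d ix) - (d ia * v iy + v ia * d iy)
  + 4%:R^-1 * (2%:R * v iz * d iz) - 4%:R^-1 * (2%:R * v iw * d iw)
  + ((d iy * v iz + v iy * d iz) * v iw + v iy * v iz * d iw).
Proof.
rewrite /hamiltonian gradD gradB gradD gradB 2!gradD.
congr (_ + _ + _ - _ + _ - _ + _).
- exact: gradXX2.
- exact: gradX2.
- exact: gradXX.
- exact: gradXX.
- exact: gradZX2.
- exact: gradZX2.
- exact: gradXXX.
Qed.

End Gradient.

Lemma mderiv_hamiltonian (x y z w t a : R[i]) : let p := tup6 x y z w t a in
  [/\ (mderiv iy (hamiltonian R)).@[p] = 2%:R * x * y - a + z * w,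
   - (mderiv ix (hamiltonian R)).@[p] = - (y ^+ 2 + 2%:R * x + t),
   (mderiv iw (hamiltonian R)).@[p] = y * z - w / 2%:R &
   - (mderiv iz (hamiltonian R)).@[p] = - (z / 2%:R + y * w)].
Proof.
split; rewrite grad_hamiltonian /tup6 /=.
(* The complex numbers are generalised to an abstract field in which [2] and [4] are still
   invertible. *)
all: by move: (R[i] : numFieldType) x y z w t a => K x y z w t a; field.
Qed.

Lemma solutionP (a0 a1 : R[i]) (D : set R[i]^o) (x y z w : R[i]^o -> R[i]^o) :
  solution a0 a1 D x y z w <->
  [/\ a0 + a1 = 1, open D & forall s, D s -> hamilton_at a0 x y z w s].
Proof.
have H s := mderiv_hamiltonian (x s) (y s) (z s) (w s) s a0.
split=> -[a01 oD sol]; split=> // s Ds; have [ex ey ez ew] := H s;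
  have [dx dy dz dw] := sol s Ds; split.
- exact: is_derive_eq dx ex.
- exact: is_derive_eq dy ey.
- exact: is_derive_eq dz ez.
- exact: is_derive_eq dw ew.
- exact: is_derive_eq dx (esym ex).
- exact: is_derive_eq dy (esym ey).
- exact: is_derive_eq dz (esym ez).
- exact: is_derive_eq dw (esym ew).
Qed.

End Hamiltonian.

(** * The transformation [s0] *)

Section S0.
Variable R : realType.
Local Notation X i := ('X_i : polyfun R).

Definition s0_den : polyfun R := X ix + X iz ^+ 2.

(** All images are put over the same denominator, even those that are already polynomial. *)
Definition s0_num : 'I_6 -> polyfun R :=
  tup6 (X ix * s0_den) (X iy * s0_den - X ia) (X iz * s0_den)
    (X iw * s0_den - 2%:R * X ia * X iz) (X it * s0_den) (- X ia * s0_den).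

Lemma tofrac_s0_den : tofrac s0_den = gx R + gz R ^+ 2.
Proof. by rewrite /s0_den tofracD tofracXn. Qed.

Lemma s0_den_neq0 : s0_den != 0.
Proof.
apply: (@meval_neq0 _ (tup6 1 0 0 0 0 0)).
by rewrite /s0_den mevalD mevalXn !mevalXU /tup6/= expr0n/= addr0 oner_eq0.
Qed.

Lemma phi_s0_den : phi (s0 R) s0_den = tofrac s0_den.
Proof. by rewrite tofrac_s0_den /s0_den phiD phiXn !phiX. Qed.

Lemma images_s0 i : images (s0 R) i * tofrac s0_den ^+ 1 = tofrac (s0_num i).
Proof.
have G0 : tofrac s0_den != 0 by rewrite tofrac_eq0 s0_den_neq0.
(* Stated over an arbitrary field: [field] does not finish on [ratfun R]. *)
have E (F : fieldType) (y a g : F) : g != 0 -> (y - a / g) * g = y * g - a.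
  by move=> ?; field.
move: i; apply: forall_I6; rewrite expr1 /images /s0_num /tup6 /=.
all: rewrite ?tofracB !tofracM ?tofracN ?tofrac_nat //.
all: by rewrite -tofrac_s0_den; apply: E.
Qed.

(** On the second application [alpha0] has changed sign and [g] has not, so the corrections to [y]
    and [w] cancel. *)
Lemma phi_s0_num i : phi (s0 R) (s0_num i) = tofrac ('X_i * s0_den ^+ 1).
Proof.
have G0 : tofrac s0_den != 0 by rewrite tofrac_eq0 s0_den_neq0.
have E (F : fieldType) (y a g : F) : g != 0 -> (y - a / g) * g + a = y * g.
  by move=> ?; field.
move: i; apply: forall_I6; rewrite expr1 /s0_num /tup6 /=.
all: rewrite ?phiB !phiM ?phiN ?phi_nat !phiX phi_s0_den tofracM ?opprK //.
all: rewrite /images /tup6 /= ?opprK //.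
all: rewrite ?mulrN ?mulNr ?opprK.
all: by rewrite -tofrac_s0_den; apply: E.
Qed.

Lemma elim_x_s0_den : elim_x s0_den s0_den = 0.
Proof. by rewrite {2}/s0_den elim_xD elim_xXn !elim_xX /= /s0_den; ring. Qed.

(** Only [- alpha0] survives, which is nonzero as a polynomial even though a given system may have
    [alpha0 = 0]. *)
Lemma elim_x_s0_num : elim_x s0_den (s0_num iy) != 0.
Proof.
rewrite /s0_num /tup6 /= elim_xB elim_xM elim_x_s0_den mulr0 sub0r elim_xX /=.
apply: (@meval_neq0 _ (fun=> 1)).
by rewrite mevalN mevalXU oppr_eq0 oner_eq0.
Qed.

(** Regularity of the new [y] forces [g] to be nonzero on [D]; the given values then agree there
    with the explicit formulas, to which [hamilton_at_s0] applies. *)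
Lemma s0_preserves_solutions : preserves_solutions (s0 R).
Proof.
move=> a0 a1 b0 b1 D x y z w X' Y Z W /solutionP [a01 oD sol] hv hb.
have a1E : a1 = 1 - a0 by rewrite -a01 addrC addKr.
(* The new parameters depend on [a0] alone, so any point will do. *)
have [hb0 hb1] := hb 0 0 0 0 0.
have b0E : b0 = - a0.
  have := @has_value_tofrac _ _ (- X ia) _ _ _ hb0.
  by rewrite mevalN mevalXU; apply; rewrite tofracN.
have b1E : b1 = a1 + 2%:R * a0.
  have := @has_value_tofrac _ _ (1 - X ia + 2%:R * X ia) _ _ _ hb1.
  rewrite mevalD mevalB mevalM meval_nat mevalXU meval1 a1E; apply.
  by rewrite tofracD tofracB tofracM tofrac_nat tofrac1.
have valP s : D s -> x s + z s ^+ 2 != 0 /\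
    [/\ x s = X' s, y s - a0 / (x s + z s ^+ 2) = Y s, z s = Z s &
    w s - 2%:R * a0 * z s / (x s + z s ^+ 2) = W s].
  move=> Ds; have [] := hv s Ds; set p := tup6 _ _ _ _ _ _ => hx hy hz hw.
  have gp : s0_den.@[p] = x s + z s ^+ 2 by rewrite mevalD mevalXn !mevalXU.
  have g0 : s0_den.@[p] != 0.
    have e := images_s0 iy; rewrite expr1 in e.
    exact: (has_value_denom_neq0 e elim_x_s0_den elim_x_s0_num hy).
  have := has_value_images g0 (images_s0 iw) hw.
  have := has_value_images g0 (images_s0 iy) hy.
  rewrite (has_value_tofrac erefl hx) (has_value_tofrac erefl hz) !mevalXU.
  rewrite /s0_num /tup6 /= !mevalB !mevalM meval_nat !mevalXU expr1 gp /=.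
  by rewrite gp in g0 => -> ->; split=> //; split; rewrite // mulrBl mulfK.
apply/solutionP; split=> [|//|s Ds]; first by rewrite b0E b1E a1E; ring.
have [g0 _] := valP s Ds.
rewrite b0E; apply: hamilton_at_congr oD Ds _ (hamilton_at_s0 (sol s Ds) g0).
by move=> u /valP[].
Qed.

Lemma param_only_s0 : param_only (im_a0 (s0 R)) /\ param_only (im_a1 (s0 R)).
Proof.
split.
  exists (- 'X), 1; split; first exact: oner_neq0.
  by rewrite rmorphN rmorph1 /= map_polyX hornerN hornerX hornerC divr1.
(* With [alpha1] eliminated, [alpha1 + 2 alpha0] is [1 + alpha0]. *)
exists (1 + 'X), 1; split; first exact: oner_neq0.
rewrite rmorphD !rmorph1 /= map_polyX hornerD hornerX !hornerC divr1.
rewrite /ga1; move: (ga0 R) => a.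
have E (F : fieldType) (u : F) : 1 - u + 2%:R * u = 1 + u by ring.
exact: E.
Qed.

Lemma backlund_s0 : backlund (s0 R).
Proof.
have [pa0 pa1] := param_only_s0; split=> //.
- exact: involution_automorphism s0_den_neq0 phi_s0_den images_s0 phi_s0_num.
- have E (F : fieldType) (u : F) : - u + (1 - u + 2%:R * u) = 1 by ring.
  exact: E.
- exact: s0_preserves_solutions.
Qed.

End S0.

(** * The transformation [s1] *)

Section S1.
Variable R : realType.
Local Notation X i := ('X_i : polyfun R).

Definition s1_den : polyfun R := X ix + X iy ^+ 2 + X iw ^+ 2 + X it.

(** The image of [x] requires the exponent 2, which is imposed on all entries; the last one uses
    [alpha0 + 2 alpha1 = 2 - alpha0]. *)
Definition s1_num : 'I_6 -> polyfun R :=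
  let a1 : polyfun R := 1 - X ia in
  tup6 (X ix * s1_den ^+ 2 + 2%:R * a1 * X iy * s1_den - a1 ^+ 2)
    ((X iy * s1_den - a1) * s1_den)
    ((X iz * s1_den + 2%:R * a1 * X iw) * s1_den)
    (X iw * s1_den ^+ 2) (X it * s1_den ^+ 2) ((2%:R - X ia) * s1_den ^+ 2).

Lemma tofrac_s1_den : tofrac s1_den = f1 R.
Proof. by rewrite /s1_den !tofracD !tofracXn. Qed.

Lemma s1_den_neq0 : s1_den != 0.
Proof.
apply: (@meval_neq0 _ (tup6 1 0 0 0 0 0)).
by rewrite /s1_den !mevalD !mevalXn !mevalXU /tup6/= expr0n/= !addr0 oner_eq0.
Qed.

Lemma phi_s1_a1 : phi (s1 R) (1 - X ia) = - (1 - ga0 R).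
Proof.
have E (F : fieldType) (a : F) : 1 - (a + 2%:R * (1 - a)) = - (1 - a) by ring.
by rewrite phiB phi1 phiX; apply: E.
Qed.

(** The change of [x] is exactly what expanding [(y - alpha1 / f1)^2] takes away from [y^2]. *)
Lemma phi_s1_den : phi (s1 R) s1_den = tofrac s1_den.
Proof.
have E (F : fieldType) (x y w t b g : F) : g != 0 ->
    (x + (2%:R * b * y) / g - b ^+ 2 / g ^+ 2) + (y - b / g) ^+ 2 + w ^+ 2 + t =
    x + y ^+ 2 + w ^+ 2 + t.
  by move=> ?; field.
rewrite tofrac_s1_den /s1_den !phiD !phiXn !phiX; apply: E.
by rewrite -tofrac_s1_den tofrac_eq0 s1_den_neq0.
Qed.

Lemma images_s1 i : images (s1 R) i * tofrac s1_den ^+ 2 = tofrac (s1_num i).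
Proof.
have G0 : tofrac s1_den != 0 by rewrite tofrac_eq0 s1_den_neq0.
have Ex (F : fieldType) (x y b g : F) : g != 0 ->
    (x + (2%:R * b * y) / g - b ^+ 2 / g ^+ 2) * g ^+ 2 =
    x * g ^+ 2 + 2%:R * b * y * g - b ^+ 2.
  by move=> ?; field.
have Ey (F : fieldType) (y b g : F) : g != 0 ->
    (y - b / g) * g ^+ 2 = (y * g - b) * g.
  by move=> ?; field.
have Ez (F : fieldType) (z w b g : F) : g != 0 ->
    (z + (2%:R * b * w) / g) * g ^+ 2 = (z * g + 2%:R * b * w) * g.
  by move=> ?; field.
have Ea (F : fieldType) (a : F) : a + 2%:R * (1 - a) = 2%:R - a by ring.
move: i; apply: forall_I6; rewrite /images /s1_num /tup6 /= -?tofrac_s1_den.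
all: move: s1_den G0 => G G0.
- rewrite tofracB tofracD [tofrac (_ * G ^+ 2)]tofracM !tofracXn !tofracM.
  by rewrite tofracB tofrac_nat tofrac1; apply: Ex.
- by rewrite tofracM tofracB tofracM tofracB tofrac1; apply: Ey.
- by rewrite tofracM tofracD !tofracM tofracB tofrac_nat tofrac1; apply: Ez.
- by rewrite tofracM tofracXn.
- by rewrite tofracM tofracXn.
- by rewrite tofracM tofracXn tofracB tofrac_nat Ea.
Qed.

(** Now [alpha1] changes sign. For [x], the shift of [y] produces [2 alpha1^2 / f1^2], which absorbs
    the two subtracted squares. *)
Lemma phi_s1_num i : phi (s1 R) (s1_num i) = tofrac ('X_i * s1_den ^+ 2).
Proof.
have G0 : tofrac s1_den != 0 by rewrite tofrac_eq0 s1_den_neq0.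
have Ex (F : fieldType) (x y b g : F) : g != 0 ->
    (x + (2%:R * b * y) / g - b ^+ 2 / g ^+ 2) * g ^+ 2 +
    2%:R * - b * (y - b / g) * g - (- b) ^+ 2 = x * g ^+ 2.
  by move=> ?; field.
have Ey (F : fieldType) (y b g : F) : g != 0 ->
    ((y - b / g) * g - - b) * g = y * g ^+ 2.
  by move=> ?; field.
have Ez (F : fieldType) (z w b g : F) : g != 0 ->
    ((z + (2%:R * b * w) / g) * g + 2%:R * - b * w) * g = z * g ^+ 2.
  by move=> ?; field.
have Ea (F : fieldType) (a : F) : 2%:R - (a + 2%:R * (1 - a)) = a by ring.
move: i; apply: forall_I6; rewrite /s1_num /tup6 /= tofracM tofracXn.
all: move: s1_den phi_s1_den tofrac_s1_den G0 => G phi_G tofrac_G G0.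
- rewrite phiB phiD [phi _ (_ * G ^+ 2)]phiM !phiXn !phiM phi_s1_a1 phi_G.
  by rewrite phi_nat !phiX /images /tup6 /= -tofrac_G; apply: Ex.
- rewrite phiM phiB phiM phi_s1_a1 phi_G phiX /images /tup6 /= -tofrac_G.
  exact: Ey.
- rewrite phiM phiD !phiM phi_s1_a1 phi_G phi_nat !phiX /images /tup6 /=.
  by rewrite -tofrac_G; apply: Ez.
- by rewrite phiM phiXn phi_G phiX.
- by rewrite phiM phiXn phi_G phiX.
- by rewrite phiM phiXn phi_G phiB phi_nat phiX /images /tup6 /= Ea.
Qed.

Lemma elim_x_s1_den : elim_x s1_den s1_den = 0.
Proof.
by rewrite {2}/s1_den !elim_xD !elim_xXn !elim_xX /= /s1_den; ring.
Qed.

(** The pole argument needs the reduced numerator: [s1_num iy] carries an extra factor [f1], which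
    eliminating [x] would send to zero. *)
Lemma im_y_s1 :
  im_y (s1 R) * tofrac s1_den = tofrac (X iy * s1_den - (1 - X ia)).
Proof.
have G0 : tofrac s1_den != 0 by rewrite tofrac_eq0 s1_den_neq0.
rewrite /= -tofrac_s1_den; move: s1_den G0 => G G0.
by rewrite tofracB tofracM tofracB tofrac1 mulrBl divfK.
Qed.

Lemma elim_x_s1_num : elim_x s1_den (X iy * s1_den - (1 - X ia)) != 0.
Proof.
rewrite elim_xB elim_xM elim_xB elim_x1 elim_x_s1_den mulr0 sub0r elim_xX /=.
apply: (@meval_neq0 _ (fun=> 0)).
by rewrite mevalN mevalB meval1 mevalXU oppr_eq0 subr0 oner_eq0.
Qed.

Lemma s1_preserves_solutions : preserves_solutions (s1 R).
Proof.
move=> a0 a1 b0 b1 D x y z w X' Y Z W /solutionP [a01 oD sol] hv hb.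
have a1E : a1 = 1 - a0 by rewrite -a01 addrC addKr.
have [hb0 hb1] := hb 0 0 0 0 0.
have b0E : b0 = a0 + 2%:R * a1.
  have := @has_value_tofrac _ _ (X ia + 2%:R * (1 - X ia)) _ _ _ hb0.
  rewrite mevalD mevalM mevalB meval_nat mevalXU meval1 a1E; apply.
  by rewrite tofracD tofracM tofracB tofrac_nat tofrac1.
have b1E : b1 = - a1.
  have := @has_value_tofrac _ _ (- (1 - X ia)) _ _ _ hb1.
  rewrite mevalN mevalB meval1 mevalXU a1E; apply.
  by rewrite tofracN tofracB tofrac1.
pose f u := x u + y u ^+ 2 + w u ^+ 2 + u.
have valP s : D s -> f s != 0 /\
    [/\ x s + 2%:R * a1 * y s / f s - a1 ^+ 2 / f s ^+ 2 = X' s,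
    y s - a1 / f s = Y s, z s + 2%:R * a1 * w s / f s = Z s & w s = W s].
  move=> Ds; have [] := hv s Ds; set p := tup6 _ _ _ _ _ _ => hx hy hz hw.
  have gp : s1_den.@[p] = f s by rewrite !mevalD !mevalXn !mevalXU.
  have g0 : s1_den.@[p] != 0.
    exact: (has_value_denom_neq0 im_y_s1 elim_x_s1_den elim_x_s1_num hy).
  have := has_value_images g0 (images_s1 iz) hz.
  have := has_value_images g0 (images_s1 iy) hy.
  have := has_value_images g0 (images_s1 ix) hx.
  rewrite (has_value_tofrac erefl hw) mevalXU /s1_num /tup6 /=.
  (* From here only the value of the denominator at [p] matters, so its expression is abstracted
     away. *)
  rewrite gp in g0; move: s1_den gp => G gp.
  rewrite !(mevalM, mevalB, mevalD, mevalXn, meval_nat, meval1, mevalXU) gp.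
  rewrite /p /tup6 /= -a1E => -> -> ->; split=> //.
  have E (F : fieldType) (u y1 z1 w1 b g : F) : g != 0 ->
      [/\ u + 2%:R * b * y1 / g - b ^+ 2 / g ^+ 2 =
        (u * g ^+ 2 + 2%:R * b * y1 * g - b ^+ 2) / g ^+ 2,
      y1 - b / g = (y1 * g - b) * g / g ^+ 2 &
      z1 + 2%:R * b * w1 / g = (z1 * g + 2%:R * b * w1) * g / g ^+ 2].
    by move=> g0'; split; field.
  by have [] := E _ (x s) (y s) (z s) (w s) a1 (f s) g0.
apply/solutionP; split=> [|//|s Ds]; first by rewrite b0E b1E a1E; ring.
have [fs0 _] := valP s Ds.
rewrite b0E; apply: hamilton_at_congr oD Ds _ (hamilton_at_s1 a01 (sol s Ds) fs0).
by move=> u /valP[].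
Qed.

Lemma param_only_s1 : param_only (im_a0 (s1 R)) /\ param_only (im_a1 (s1 R)).
Proof.
split.
  exists (1 + (1 - 'X)), 1; split; first exact: oner_neq0.
  rewrite rmorphD rmorphB !rmorph1 /= map_polyX !hornerD hornerN hornerX !hornerC.
  rewrite divr1 /ga1; move: (ga0 R) => a.
  have E (F : fieldType) (u : F) : u + 2%:R * (1 - u) = 1 + (1 - u) by ring.
  exact: E.
exists ('X - 1), 1; split; first exact: oner_neq0.
rewrite rmorphB !rmorph1 /= map_polyX hornerD hornerN hornerX !hornerC divr1.
by rewrite opprB.
Qed.

Lemma backlund_s1 : backlund (s1 R).
Proof.
have [pa0 pa1] := param_only_s1; split=> //.
- exact: involution_automorphism s1_den_neq0 phi_s1_den images_s1 phi_s1_num.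
- have E (F : fieldType) (u : F) : u + 2%:R * (1 - u) + - (1 - u) = 1 by ring.
  exact: E.
- exact: s1_preserves_solutions.
Qed.

End S1.

(** The infinite dihedral group has no relation mixing the two generators, so the two involutivity
    statements are all its defining relations. *)
Theorem theorem3p1 (R : realType) :
  [/\ backlund (s0 R), backlund (s1 R),
      subst (s0 R) \o subst (s0 R) =1 id &
      subst (s1 R) \o subst (s1 R) =1 id].
Proof.
split.
- exact: backlund_s0.
- exact: backlund_s1.
- exact: subst_involutive (s0_den_neq0 R) (phi_s0_den R) (@images_s0 R) (@phi_s0_num R).
- exact: subst_involutive (s1_den_neq0 R) (phi_s1_den R) (@images_s1 R) (@phi_s1_num R).
Qed.
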